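(* For every nonzero-sum mean-payoff game $\mathcal{G}$ with set of vertices $V$, every $\epsilon>0$, every vertex $v\in V$, and every strategy $\sigma_0$ of Player 0: $$\forall\mathcal{H}\in\mathcal{G}^{\pm\epsilon}:\quad \mathsf{ASV}_{\mathcal{H}}(\sigma_0)(v)>\inf_{\sigma_1\in\mathsf{BR}^{2\epsilon}_{1,\mathcal{G}}(\sigma_0)}\underline{\mathsf{MP}}^{\mathcal{G}}_0(\mathsf{Out}_v(\sigma_0,\sigma_1))-\epsilon .$$
   Context: An arena $(V,E,\langle V_0,V_1\rangle,w_0,w_1)$ consists of a finite set $V$ of vertices, a set $E\subseteq V\times V$ of edges such that every vertex has at least one successor, a partition of $V$ into $V_0$ (Player 0) and $V_1$ (Player 1), and weight functions $w_0,w_1:E\to\mathbb{Z}$. A (nonzero-sum) mean-payoff game $\mathcal{G}$ is played on such an arena. A play is an infinite path $\pi=\pi_0\pi_1\dots$; a history is a nonempty finite prefix of a play. The payoff of Player $i\in\{0,1\}$ is $\underline{\mathsf{MP}}_i(\pi)=\liminf_{k\to\infty}\frac1k w_i(\pi_0\dots\pi_k)$, where $w_i$ of a history is the sum of the $w_i$-weights of its edges; a superscript $\mathcal{G}$ indicates that the weights of $\mathcal{G}$ are used. A strategy of Player $i$ maps each history ending in a vertex of $V_i$ to a successor of that last vertex; $\Sigma_i$ is the set of strategies of Player $i$. $\mathsf{Out}_v(\sigma_0,\sigma_1)$ is the unique play from $v$ consistent with $\sigma_0$ and $\sigma_1$. For $\eta>0$ and a game $\mathcal{G}$, $\mathsf{BR}^{\eta}_{1,\mathcal{G}}(\sigma_0)$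 is the set of $\sigma_1\in\Sigma_1$ such that for all $v\in V$ and all $\sigma_1'\in\Sigma_1$: $\underline{\mathsf{MP}}^{\mathcal{G}}_1(\mathsf{Out}_v(\sigma_0,\sigma_1))>\underline{\mathsf{MP}}^{\mathcal{G}}_1(\mathsf{Out}_v(\sigma_0,\sigma_1'))-\eta$. The adversarial Stackelberg value of $\sigma_0$ at $v$ in a game $\mathcal{H}$ is $\mathsf{ASV}_{\mathcal{H}}(\sigma_0)(v)=\sup_{\eta>0}\inf_{\sigma_1\in\mathsf{BR}^{\eta}_{1,\mathcal{H}}(\sigma_0)}\underline{\mathsf{MP}}^{\mathcal{H}}_0(\mathsf{Out}_v(\sigma_0,\sigma_1))$. For $\delta>0$, $\mathcal{G}^{\pm\delta}$ is the set of games $\mathcal{H}$ with the same $V,E,V_0,V_1$ as $\mathcal{G}$ and with real weight functions $w_0',w_1'$ satisfying $w_i'(e)\in(w_i(e)-\delta,w_i(e)+\delta)$ for all $e\in E$, $i\in\{0,1\}$. Strategies in $\mathcal{G}$ and $\mathcal{H}$ coincide. *)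

(* Defs.v *)
From mathcomp Require Import all_boot all_order all_algebra.
From mathcomp Require Import all_classical all_reals all_analysis.

Set Implicit Arguments.
Unset Strict Implicit.
Unset Printing Implicit Defensive.

Import Order.TTheory GRing.Theory Num.Theory.

Local Open Scope classical_set_scope.
Local Open Scope ring_scope.

Variant player := P0 | P1.

Record graph (V : finType) := Graph {
  edge : rel V;
  own : player -> {set V};
  edge_total : forall x, exists y, edge x y;
  own_partition : own P1 = ~: own P0
}.

(* Only the values of [weight i] on pairs related by [edge A] matter. *)
Record game (V : finType) (A : graph V) (W : Type) := Game {
  weight : player -> V -> V -> W
}.

(* A history is [x :: p] with [path (edge A) x p].  The value of a strategy on
   sequences that are not histories ending in [own A i] is irrelevant: it is
   never consulted by [Out] below. *)
Record strategy (V : finType) (A : graph V) (i : player) := Strategy {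
  strat :> V -> seq V -> V;
  strat_edge : forall x p, path (edge A) x p -> last x p \in own A i ->
    edge A (last x p) (strat x p)
}.

Definition is_play (V : finType) (A : graph V) (pi : nat -> V) : Prop :=
  forall n, edge A (pi n) (pi n.+1).

(* [pi 1; ...; pi n], so that [pi 0 :: ptail pi n] is the history
   [pi 0; ...; pi n]. *)
Definition ptail (V : finType) (pi : nat -> V) (n : nat) : seq V :=
  [seq pi k | k <- iota 1 n].

Definition consistent (V : finType) (A : graph V) (i : player)
    (s : strategy A i) (pi : nat -> V) : Prop :=
  forall n, pi n \in own A i -> pi n.+1 = s (pi 0%N) (ptail pi n).

Fixpoint out_tail (V : finType) (A : graph V)
    (s0 : strategy A P0) (s1 : strategy A P1) (v : V) (n : nat) : seq V :=
  if n is m.+1 then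
    let p := out_tail s0 s1 v m in
    rcons p (if last v p \in own A P0 then s0 v p else s1 v p)
  else [::].

Definition Out (V : finType) (A : graph V)
    (s0 : strategy A P0) (s1 : strategy A P1) (v : V) (n : nat) : V :=
  last v (out_tail s0 s1 v n).

Lemma ptailS (V : finType) (pi : nat -> V) n :
  ptail pi n.+1 = rcons (ptail pi n) (pi n.+1).
Proof. by rewrite /ptail -{1}(addn1 n) iotaD map_cat /= cats1 add1n. Qed.

Lemma last_ptail (V : finType) (pi : nat -> V) n :
  last (pi 0%N) (ptail pi n) = pi n.
Proof. by case: n => [|n] //; rewrite ptailS last_rcons. Qed.

Lemma ptail_Out (V : finType) (A : graph V)
    (s0 : strategy A P0) (s1 : strategy A P1) (v : V) n :
  ptail (Out s0 s1 v) n = out_tail s0 s1 v n.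
Proof. by elim: n => [|n IH] //; rewrite ptailS IH /Out /= last_rcons. Qed.

Lemma out_tail_path (V : finType) (A : graph V)
    (s0 : strategy A P0) (s1 : strategy A P1) (v : V) n :
  path (edge A) v (out_tail s0 s1 v n).
Proof.
elim: n => [|n IH] //=; rewrite rcons_path IH /=.
case: ifP => h; first exact: strat_edge.
by apply: strat_edge => //; rewrite own_partition inE h.
Qed.

Lemma Out_play (V : finType) (A : graph V)
    (s0 : strategy A P0) (s1 : strategy A P1) (v : V) :
  [/\ Out s0 s1 v 0%N = v, is_play A (Out s0 s1 v),
      consistent s0 (Out s0 s1 v) & consistent s1 (Out s0 s1 v)].
Proof.
split=> // n.
- have := out_tail_path s0 s1 v n.+1.
  by rewrite /= rcons_path => /andP[_]; rewrite /Out /= last_rcons.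
- by move=> h; rewrite ptail_Out {1}/Out /= last_rcons ifT.
- move=> h; rewrite ptail_Out {1}/Out /= last_rcons ifN //.
  by move: h; rewrite own_partition inE.
Qed.

Lemma Out_unique (V : finType) (A : graph V)
    (s0 : strategy A P0) (s1 : strategy A P1) (v : V) (pi : nat -> V) :
  pi 0%N = v -> consistent s0 pi -> consistent s1 pi -> pi =1 Out s0 s1 v.
Proof.
move=> pi0 c0 c1.
have E n : ptail pi n = out_tail s0 s1 v n.
  elim: n => [|n IH] //; rewrite ptailS IH /=; congr rcons.
  have <- : pi n = last v (out_tail s0 s1 v n).
    by rewrite -IH -pi0 last_ptail.
  rewrite -IH -pi0; case: ifP => h; first exact: c0.
  by apply: c1; rewrite own_partition inE h.
by move=> n; rewrite /Out -E -pi0 last_ptail.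
Qed.

Definition real_game (R : realType) (V : finType) (A : graph V)
    (G : game A int) : game A R :=
  Game A (fun i x y => (weight G i x y)%:~R).

Definition MP (R : realType) (V : finType) (A : graph V) (H : game A R)
    (i : player) (pi : nat -> V) : \bar R :=
  limn_einf (fun k : nat =>
    (k%:R^-1 * \sum_(0 <= n < k) weight H i (pi n) (pi n.+1))%:E).

Definition BR (R : realType) (V : finType) (A : graph V) (H : game A R)
    (eta : R) (s0 : strategy A P0) : set (strategy A P1) :=
  [set s1 | forall (v : V) (s1' : strategy A P1),
     (MP H P1 (Out s0 s1' v) - eta%:E < MP H P1 (Out s0 s1 v))%E].

Definition infBR (R : realType) (V : finType) (A : graph V) (H : game A R)
    (eta : R) (s0 : strategy A P0) (v : V) : \bar R :=
  ereal_inf [set MP H P0 (Out s0 s1 v) | s1 in BR H eta s0].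

Definition ASV (R : realType) (V : finType) (A : graph V) (H : game A R)
    (s0 : strategy A P0) (v : V) : \bar R :=
  ereal_sup [set infBR H eta s0 v | eta in [set eta : R | 0 < eta]].

Definition perturbations (R : realType) (V : finType) (A : graph V)
    (G : game A int) (delta : R) : set (game A R) :=
  [set H | forall i x y, edge A x y ->
     (weight G i x y)%:~R - delta < weight H i x y
       < (weight G i x y)%:~R + delta].

(* Main.v *)
Require Import Defs.
From mathcomp Require Import all_boot all_order all_algebra.
From mathcomp Require Import all_classical all_reals all_analysis.
From mathcomp Require Import lra.

(** As there are finitely many edges, the weights of a game [H] in the open
    [eps]-ball around [G] differ from those of [G] by at most some [d < eps].
    Hence mean payoffs differ by at most [d], and every
    [2 * (eps - d)]-best response in [H] is a [2 * eps]-best response in [G].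
    The value of [s0] in [H] at [eta = 2 * (eps - d)] is thus at least the
    infimum in [G] minus [d].  This is strictly more than the infimum minus
    [eps] because the infimum is finite: payoffs are bounded, and best responses
    up to [eta > 0] exist, as a strategy may be chosen separately for each
    initial vertex. *)

Set Implicit Arguments.
Unset Strict Implicit.
Unset Printing Implicit Defensive.

Import Order.TTheory GRing.Theory Num.Theory.

Local Open Scope classical_set_scope.
Local Open Scope ring_scope.

Lemma le_limn_einf (R : realType) (u w : (\bar R)^nat) :
  (forall n, u n <= w n)%E -> (limn_einf u <= limn_einf w)%E.
Proof.
move=> uw; rewrite !limn_einf_lim; apply: lee_lim; try exact: is_cvg_einfs.
apply: nearW => n /=; apply: le_ereal_inf_tmp => _ [k nk <-].
by apply: le_trans (uw k); apply: ereal_inf_lbound; exists k.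
Qed.

Lemma MP_le (R : realType) (V : finType) (A : graph V) (H K : game A R)
    (d : R) (i : player) (pi : nat -> V) :
  0 <= d -> is_play A pi ->
  (forall x y, edge A x y -> weight H i x y <= weight K i x y + d) ->
  (MP H i pi <= MP K i pi + d%:E)%E.
Proof.
move=> d0 ppi HK; rewrite /MP addeC -limn_einf_shift//.
apply: le_limn_einf => k; rewrite -EFinD lee_fin.
(* Since [0^-1 = 0], the average at [k = 0] is [0] in both games, and the inequality there is just
   [0 <= d]. *)
have [->|k0] := posnP k; first by rewrite invr0 !mul0r addr0.
rewrite -[d](@mulKf _ k%:R) ?pnatr_eq0 -?lt0n// -mulrDr.
rewrite ler_wpM2l ?invr_ge0//.
have -> : k%:R * d = \sum_(0 <= n < k) d.
  by rewrite sumr_const_nat subn0 mulr_natl.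
by rewrite -big_split /=; apply: ler_sum => n _; rewrite addrC HK.
Qed.

(** Both bounds come from [MP_le], comparing [H] with the game [Z] of zero weights, whose mean
    payoffs all vanish. *)
Lemma MP_bounded (R : realType) (V : finType) (A : graph V) (H : game A R)
    (i : player) :
  exists M : R, forall pi, is_play A pi -> (- M%:E <= MP H i pi <= M%:E)%E.
Proof.
pose Z : game A R := Game A (fun _ _ _ => 0).
have MPZ pi : MP Z i pi = 0%E.
  rewrite /MP (_ : (fun _ => _) = cst 0%E); last first.
    by apply/funext => k; rewrite big1// mulr0.
  by have [-> _] := cvg_limn_einf_sup (cvg_cst (0 : \bar R)%E).
pose M := \big[Num.max/0]_(t : V * V) `|weight H i t.1 t.2|.
have M0 : 0 <= M by exact: bigmax_ge_id.
have leM x y : `|weight H i x y| <= M.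
  exact: (le_bigmax 0 (fun t : V * V => `|weight H i t.1 t.2|) (x, y)).
exists M => pi ppi; apply/andP; split.
  rewrite -[leLHS]add0e leeBlDr// -(MPZ pi).
  apply: MP_le => // x y _ /=.
  by have := leM x y; rewrite ler_norml => /andP[? _]; lra.
rewrite -[leRHS]add0e -(MPZ pi); apply: MP_le => // x y _ /=.
by have := leM x y; rewrite ler_norml => /andP[_ ?]; lra.
Qed.

Lemma MP_fin_num (R : realType) (V : finType) (A : graph V) (H : game A R)
    (i : player) (pi : nat -> V) :
  is_play A pi -> MP H i pi \is a fin_num.
Proof.
move=> ppi; have [M /(_ _ ppi) /andP[l u]] := MP_bounded H i.
by rewrite fin_numE -ltNye -ltey (lt_le_trans _ l) ?ltNyr// (le_lt_trans u) ?ltry.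
Qed.

Lemma perturbations_uniform (R : realType) (V : finType) (A : graph V)
    (G : game A int) (eps : R) (H : game A R) :
  0 < eps -> perturbations G eps H ->
  exists2 d, 0 <= d < eps & forall i x y, edge A x y ->
    `|weight H i x y - weight (real_game R G) i x y| <= d.
Proof.
move=> e0 hH.
pose D i (t : V * V) :=
  `|weight H i t.1 t.2 - weight (real_game R G) i t.1 t.2|.
(* Only edges are ranged over, as [H] is unconstrained on other pairs. The default [0] keeps the
   maximum nonnegative, and also below [eps] because [0 < eps]. *)
pose m i := \big[Num.max/0]_(t : V * V | edge A t.1 t.2) D i t.
have m0 i : 0 <= m i by exact: bigmax_ge_id.
have me i : m i < eps.
  apply: bigmax_lt => // -[x y] /= exy; rewrite /D /= ltr_distl.
  exact: hH.
exists (Num.max (m P0) (m P1)); first by rewrite le_max m0 gt_max !me.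
move=> i x y exy; have : D i (x, y) <= m i.
  exact: (le_bigmax_cond 0 (D i) (j := (x, y))).
by rewrite le_max; case: i => -> //; rewrite orbT.
Qed.

Lemma strategy_inhabited (V : finType) (A : graph V) (i : player) :
  inhabited (strategy A i).
Proof.
apply: inhabits.
apply: (@Strategy _ _ _ (fun x p => projT1 (cid (edge_total A (last x p))))).
by move=> x p _ _; case: (cid _).
Qed.

(** A history records its initial vertex [x], so a single strategy can follow [f x] on all histories
    from [x]. *)
Lemma strategy_merge (V : finType) (A : graph V) (s0 : strategy A P0)
    (f : V -> strategy A P1) :
  exists s1 : strategy A P1, forall v, Out s0 s1 v = Out s0 (f v) v.
Proof.
exists (@Strategy _ _ _ (fun x p => f x x p) (fun x p => @strat_edge _ _ _ _ x p)).
by move=> v; apply/funext => n; congr last; elim: n => //= n ->.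
Qed.

Lemma BR_nonempty (R : realType) (V : finType) (A : graph V) (H : game A R)
    (eta : R) (s0 : strategy A P0) :
  0 < eta -> BR H eta s0 !=set0.
Proof.
move=> eta0; have [t] := strategy_inhabited A P1.
have plays s v : is_play A (Out s0 s v) by case: (Out_play s0 s v).
pose S v := [set MP H P1 (Out s0 s1 v) | s1 in [set: strategy A P1]].
have Sfin v : ereal_sup (S v) \is a fin_num.
  have [M bM] := MP_bounded H P1.
  rewrite fin_numE -ltNye -ltey; apply/andP; split.
    apply: (@lt_le_trans _ _ (MP H P1 (Out s0 t v))).
      by rewrite ltNye_eq MP_fin_num.
    by apply: ereal_sup_ubound; exists t.
  apply: (@le_lt_trans _ _ M%:E); last exact: ltry.
  by apply: ge_ereal_sup => _ [s _ <-]; have /andP[] := bM _ (plays s v).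
(* The supremum may not be attained, but being finite it is approached within [eta]. *)
have near v : exists s1,
    (ereal_sup (S v) - eta%:E < MP H P1 (Out s0 s1 v))%E.
  have [_ [s1 _ <-] ?] := ub_ereal_sup_adherent eta0 (Sfin v).
  by exists s1.
have [f hf] := choice near.
have [s1 hs1] := strategy_merge s0 f.
exists s1 => v s1'; rewrite hs1; apply: le_lt_trans (hf v).
by apply: leeB => //; apply: ereal_sup_ubound; exists s1'.
Qed.

Theorem theorem5 (R : realType) (V : finType) (A : graph V) (G : game A int)
    (eps : R) (heps : 0 < eps) (v : V) (s0 : strategy A P0) (H : game A R)
    (hH : perturbations G eps H) :
  (ASV H s0 v >
   ereal_inf [set MP (real_game R G) P0 (Out s0 s1 v)
             | s1 in BR (real_game R G) (2 * eps) s0]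
   - eps%:E)%E.
Proof.
have [d /andP[d0 de] hd] := perturbations_uniform heps hH.
set K := real_game R G in hd *.
have play s u : is_play A (Out s0 s u) by case: (Out_play s0 s u).
have HK i s u : (MP H i (Out s0 s u) <= MP K i (Out s0 s u) + d%:E)%E.
  apply: MP_le => // x y /(hd i); rewrite ler_norml => /andP[_ ?]; lra.
have KH i s u : (MP K i (Out s0 s u) <= MP H i (Out s0 s u) + d%:E)%E.
  apply: MP_le => // x y /(hd i); rewrite ler_norml => /andP[? _]; lra.
have fin (L : game A R) i s u := MP_fin_num L i (play s u).
set I := ereal_inf _.
have Ifin : I \is a fin_num.
  have [M bM] := MP_bounded K P0.
  rewrite fin_numE -ltNye -ltey; apply/andP; split.
    apply: (@lt_le_trans _ _ (- M%:E)%E); first exact: ltNyr.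
    by apply: le_ereal_inf_tmp => _ [s _ <-]; have /andP[] := bM _ (play s v).
  (* An infimum over no best responses would be [+oo]; a single best response bounds it by a finite
     payoff. *)
  have [|s Bs] := @BR_nonempty R V A K (2 * eps) s0; first by lra.
  apply: (@le_lt_trans _ _ (MP K P0 (Out s0 s v))).
    by apply: ereal_inf_lbound; exists s.
  by rewrite ltey_eq fin.
(* Passing from [H] to [K] costs [d] for each of the two payoffs compared in a best response, and
   [2 * (eps - d) + 2 * d = 2 * eps]. *)
have eta0 : 0 < 2 * (eps - d) by lra.
apply: (@lt_le_trans _ _ (I - d%:E)%E).
  by rewrite -(fineK Ifin) -!EFinB lte_fin; lra.
apply: (@le_trans _ _ (infBR H (2 * (eps - d)) s0 v)); last first.
  by apply: ereal_sup_ubound; exists (2 * (eps - d)).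
apply: le_ereal_inf_tmp => _ [s1 Bs1 <-]; rewrite leeBlDr//.
apply: (le_trans _ (KH P0 s1 v)); apply: ereal_inf_lbound.
exists s1 => // u s1'.
(* All four payoffs are finite, so the chain [K(s1') - 2 * eps <= H(s1') + d - 2 * eps < H(s1) - d
   <= K(s1)] is linear arithmetic over the reals. *)
move: (Bs1 u s1') (HK P1 s1 u) (KH P1 s1' u).
rewrite -(fineK (fin H P1 s1 u)) -(fineK (fin K P1 s1 u)).
rewrite -(fineK (fin H P1 s1' u)) -(fineK (fin K P1 s1' u)).
by rewrite -!EFinB -!EFinD !lte_fin !lee_fin; lra.
Qed.
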